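(* Let $\mathfrak{P}=(\rho_{t_0},\mathcal{E}_{t_1\leftarrow t_0},\dots,\mathcal{E}_{t_n\leftarrow t_{n-1}})$ be a multi-time quantum process with $\mathcal{H}_{t_k}=\mathbb{C}^d$ for all $k$, and let $\overrightarrow{\Upsilon},\overleftarrow{\Upsilon},\overleftrightarrow{\Upsilon},\Upsilon^{\rm MH},\overleftrightarrow{\Upsilon}^{\rm MH}$ be its right, left, doubled KD temporal states and its left/right and doubled MH temporal states. Then: (1) $\overrightarrow{\Upsilon}=\operatorname{Tr}_L\overleftrightarrow{\Upsilon}$, $\overleftarrow{\Upsilon}=\operatorname{Tr}_R\overleftrightarrow{\Upsilon}$, and $\overrightarrow{\Upsilon}=\overleftarrow{\Upsilon}^\dagger$. For every $k$, $\rho_{t_k}=\operatorname{Tr}_{t_n,\dots,\widehat{t_k},\dots,t_0}\overrightarrow{\Upsilon}=\operatorname{Tr}_{t_n,\dots,\widehat{t_k},\dots,t_0}\overleftarrow{\Upsilon}$, where $\rho_{t_k}=\mathcal{E}_{t_k\leftarrow t_{k-1}}\circ\cdots\circ\mathcal{E}_{t_1\leftarrow t_0}(\rho_{t_0})$ and the partial trace is over all time steps except $t_k$. Moreover the quantum Kolmogorov consistency condition holds: for any $0=i_0<i_1<\dots<i_k\le n$, the partial trace of $\overrightarrow{\Upsilon}$ (resp. $\overleftarrow{\Upsilon}$) over the time steps not in $\{t_{i_0},\dots,t_{i_k}\}$, and the partial trace of $\overleftrightarrow{\Upsilon}$ over both the $L$ and $R$ factors of those time steps, equal the corresponding KD temporal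 states of the sub-process $(\rho_{t_0},\mathcal{E}'_{t_{i_1}\leftarrow t_{i_0}},\dots,\mathcal{E}'_{t_{i_k}\leftarrow t_{i_{k-1}}})$ with $\mathcal{E}'_{t_{i_j}\leftarrow t_{i_{j-1}}}=\mathcal{E}_{t_{i_j}\leftarrow t_{i_j-1}}\circ\cdots\circ\mathcal{E}_{t_{i_{j-1}+1}\leftarrow t_{i_{j-1}}}$. (2) $\Upsilon^{\rm MH}=\tfrac12(\overleftarrow{\Upsilon}+\overleftarrow{\Upsilon}^\dagger)=\tfrac12(\overrightarrow{\Upsilon}+\overrightarrow{\Upsilon}^\dagger)$ and $\overleftrightarrow{\Upsilon}^{\rm MH}=\tfrac12(\overleftrightarrow{\Upsilon}+\overleftrightarrow{\Upsilon}^\dagger)$; in particular $\rho_{t_k}$ is also the partial trace of $\Upsilon^{\rm MH}$ over all time steps except $t_k$. (3) (Temporal Born rule) For any complete families of orthogonal projectors $\{\Pi^{t_k}_{a}\}$, $\{\Pi^{t_k}_{b}\}$ at each time step: $\overrightarrow{Q}_{\rm KD}(b_n,\dots,b_0)=\operatorname{Tr}[(\Pi_{b_n}\otimes\cdots\otimes\Pi_{b_0})\overrightarrow{\Upsilon}]$; $\overleftarrow{Q}_{\rm KD}(b_n,\dots,b_0)=\operatorname{Tr}[(\Pi_{b_n}\otimes\cdots\otimes\Pi_{b_0})\overleftarrow{\Upsilon}]$; $\overleftrightarrow{Q}_{\rm KD}(a_n,\dots,a_0;b_n,\dots,b_0)=\operatorname{Tr}[(\Pi_{a_n}\otimes\cdots\otimes\Pi_{a_0})\otimes(\Pi_{b_n}\otimes\cdots\otimes\Pi_{b_0})\overleftrightarrow{\Upsilon}]$;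 $Q_{\rm MH}(b_n,\dots,b_0)=\operatorname{Tr}[(\Pi_{b_n}\otimes\cdots\otimes\Pi_{b_0})\Upsilon^{\rm MH}]$; $\overleftrightarrow{Q}_{\rm MH}(a;b)=\operatorname{Tr}[(\Pi_{a_n}\otimes\cdots\otimes\Pi_{a_0})\otimes(\Pi_{b_n}\otimes\cdots\otimes\Pi_{b_0})\overleftrightarrow{\Upsilon}^{\rm MH}]$; and $Q_{\rm LvN}(a_n,\dots,a_0)=\operatorname{Tr}[(\Pi_{a_n}\otimes\cdots\otimes\Pi_{a_0})\otimes(\Pi_{a_n}\otimes\cdots\otimes\Pi_{a_0})\overleftrightarrow{\Upsilon}]=\operatorname{Tr}[(\Pi_{a_n}\otimes\cdots\otimes\Pi_{a_0})\otimes(\Pi_{a_n}\otimes\cdots\otimes\Pi_{a_0})\overleftrightarrow{\Upsilon}^{\rm MH}]$.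
   Context: A multi-time quantum process consists of a density operator $\rho_{t_0}$ on $\mathbb{C}^d$ and CPTP maps $\mathcal{E}_{t_j\leftarrow t_{j-1}}$ on $\mathbf{B}(\mathbb{C}^d)$, extended linearly to all operators. Given complete families of orthogonal projectors, the right, left and doubled temporal KD distributions are $\overrightarrow{Q}_{\rm KD}(b_n,\dots,b_0)=\operatorname{Tr}[\mathcal{E}_{t_n\leftarrow t_{n-1}}(\cdots\mathcal{E}_{t_1\leftarrow t_0}(\rho_{t_0}\Pi^{t_0}_{b_0})\Pi^{t_1}_{b_1}\cdots)\Pi^{t_n}_{b_n}]$, $\overleftarrow{Q}_{\rm KD}(a_n,\dots,a_0)=\operatorname{Tr}[\Pi^{t_n}_{a_n}\mathcal{E}_{t_n\leftarrow t_{n-1}}(\cdots\Pi^{t_1}_{a_1}\mathcal{E}_{t_1\leftarrow t_0}(\Pi^{t_0}_{a_0}\rho_{t_0})\cdots)]$, $\overleftrightarrow{Q}_{\rm KD}(a_n,\dots,a_0;b_n,\dots,b_0)=\operatorname{Tr}[\Pi^{t_n}_{a_n}\mathcal{E}_{t_n\leftarrow t_{n-1}}(\cdots\Pi^{t_1}_{a_1}\mathcal{E}_{t_1\leftarrow t_0}(\Pi^{t_0}_{a_0}\rho_{t_0}\Pi^{t_0}_{b_0})\Pi^{t_1}_{b_1}\cdots)\Pi^{t_n}_{b_n}]$. The Margenau–Hill (MH) distributions are $Q_{\rm MH}=\operatorname{Re}\overrightarrow{Q}_{\rm KD}$ and $\overleftrightarrow{Q}_{\rm MH}=\operatorname{Re}\overleftrightarrow{Q}_{\rm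 KD}$; the Lüders–von Neumann distribution is $Q_{\rm LvN}(a_n,\dots,a_0)=\overleftrightarrow{Q}_{\rm KD}(a_n,\dots,a_0;a_n,\dots,a_0)$ (same projectors on both sides). Generalized Pauli operators: Hermitian $\sigma_0=\mathbb{I},\sigma_1,\dots,\sigma_{d^2-1}$ on $\mathbb{C}^d$ with $\operatorname{Tr}\sigma_j=0$ ($j\ge1$), $\operatorname{Tr}(\sigma_\mu\sigma_\nu)=d\,\delta_{\mu\nu}$. For each $\sigma_\mu$ use its spectral projectors as measurement, with outcomes its eigenvalues. Correlators: $\overrightarrow{T}^{\mu_n,\dots,\mu_0}=\sum a_n\cdots a_0\,\overrightarrow{Q}_{\rm KD}(a_n,\dots,a_0\mid\sigma_{\mu_n},\dots,\sigma_{\mu_0})$, $\overleftarrow{T}$ analogously from $\overleftarrow{Q}_{\rm KD}$, and $\overleftrightarrow{T}^{\mu_n,\dots,\mu_0;\nu_n,\dots,\nu_0}=\sum a_n\cdots a_0b_n\cdots b_0\,\overleftrightarrow{Q}_{\rm KD}(a;b\mid\sigma_{\mu_n},\dots,\sigma_{\mu_0};\sigma_{\nu_n},\dots,\sigma_{\nu_0})$ (ket side measured with the $\sigma_{\mu}$'s, bra side with the $\sigma_\nu$'s). The KD temporal states on $\mathcal{H}_{t_n}\otimes\cdots\otimes\mathcal{H}_{t_0}$ are $\overrightarrow{\Upsilon}=d^{-(n+1)}\sum_{\mu}\overrightarrow{T}^{\mu_n,\dots,\mu_0}\sigma_{\mu_n}\otimes\cdots\otimes\sigma_{\mu_0}$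 and $\overleftarrow{\Upsilon}$ likewise with $\overleftarrow{T}$; the doubled KD temporal state on $L\otimes R$, with $L=R=\mathcal{H}_{t_n}\otimes\cdots\otimes\mathcal{H}_{t_0}$, is $\overleftrightarrow{\Upsilon}=d^{-2(n+1)}\sum_{\mu,\nu}\overleftrightarrow{T}^{\mu_n,\dots,\mu_0;\nu_n,\dots,\nu_0}(\bigotimes_i\sigma_{\mu_i})\otimes(\bigotimes_j\sigma_{\nu_j})$. The MH temporal states $\Upsilon^{\rm MH}$ and $\overleftrightarrow{\Upsilon}^{\rm MH}$ are defined by the same formulas with the correlators replaced by $\operatorname{Re}\overrightarrow{T}$ and $\operatorname{Re}\overleftrightarrow{T}$ respectively. *)

(* Defs.v *)
(* Finite-dimensional operators are represented as plain
   matrix-valued functions [Op C I := I -> I -> C] on a finite index type I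
   (the computational basis), over an arbitrary numClosedFieldType C
   (e.g. algC, or complex numbers over a real closed field). *)
From HB Require Import structures.
From mathcomp Require Import all_boot all_order all_algebra.
Unset Printing Implicit Defensive.
Import Order.TTheory GRing.Theory Num.Theory.
Local Open Scope ring_scope.

Definition Op (C : Type) (I : finType) := I -> I -> C.

Section Ops.
Context {C : numClosedFieldType}.

Definition opmul {I : finType} (A B : Op C I) : Op C I :=
  fun i j => \sum_k A i k * B k j.
Definition opone {I : finType} : Op C I := fun i j => (i == j)%:R.
Definition opzero {I : finType} : Op C I := fun _ _ => 0.
Definition opadd {I : finType} (A B : Op C I) : Op C I := fun i j => A i j + B i j.
Definition opscale {I : finType} (a : C) (A : Op C I) : Op C I :=
  fun i j => a * A i j.
Definition optr {I : finType} (A : Op C I) : C := \sum_i A i i.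
Definition opadj {I : finType} (A : Op C I) : Op C I := fun i j => (A j i)^*.
Definition opkron {I J : finType} (A : Op C I) (B : Op C J) : Op C (I * J)%type :=
  fun x y => A x.1 y.1 * B x.2 y.2.

Definition psd {I : finType} (A : Op C I) : Prop :=
  forall v : I -> C, 0 <= \sum_i \sum_j (v i)^* * A i j * v j.
Definition density {I : finType} (rho : Op C I) : Prop :=
  psd rho /\ optr rho = 1.

Definition linmap {I J : finType} (E : Op C I -> Op C J) : Prop :=
  forall a X Y, E (opadd (opscale a X) Y) = opadd (opscale a (E X)) (E Y).
Definition ampliate (m : nat) {I J : finType} (E : Op C I -> Op C J)
  (X : Op C ('I_m * I)%type) : Op C ('I_m * J)%type :=
  fun p q => E (fun i j => X (p.1, i) (q.1, j)) p.2 q.2.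
Definition completely_positive {I J : finType} (E : Op C I -> Op C J) : Prop :=
  forall (m : nat) (X : Op C ('I_m * I)%type), psd X -> psd (ampliate m E X).
Definition trace_preserving {I J : finType} (E : Op C I -> Op C J) : Prop :=
  forall X, optr (E X) = optr X.
Definition cptp {I J : finType} (E : Op C I -> Op C J) : Prop :=
  [/\ linmap E, completely_positive E & trace_preserving E].

Definition is_proj {I : finType} (P : Op C I) : Prop :=
  opmul P P = P /\ opadj P = P.
Definition proj_family {I A : finType} (P : A -> Op C I) : Prop :=
  [/\ forall a, is_proj (P a),
      forall a b, a != b -> opmul (P a) (P b) = opzero
    & forall i j, \sum_a P a i j = opone i j].

(* (ev, P) is the spectral decomposition of S: the P a are the spectral
   projectors (padded with zero projectors, outcomes indexed by 'I_d since
   there are at most d distinct eigenvalues) and ev a the eigenvalues. *)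
Definition spectral_decomp {d : nat} (S : Op C 'I_d) (ev : 'I_d -> C)
    (P : 'I_d -> Op C 'I_d) : Prop :=
  [/\ proj_family P,
      forall i j, \sum_a ev a * P a i j = S i j
    & forall a b, a != b -> P a <> opzero -> P b <> opzero -> ev a != ev b].

Definition gen_pauli {d : nat} (sigma : 'I_(d ^ 2) -> Op C 'I_d) : Prop :=
  [/\ forall mu : 'I_(d ^ 2), val mu = 0%N -> sigma mu = opone,
      forall mu, opadj (sigma mu) = sigma mu,
      forall mu : 'I_(d ^ 2), val mu <> 0%N -> optr (sigma mu) = 0
    & forall mu nu, optr (opmul (sigma mu) (sigma nu)) = (d * (mu == nu))%:R].

(* ---------- KD distributions ----------
   Time steps t_0..t_n; E j is the map E_{t_{j+1} <- t_j} (only j < n used);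
   L k / R k are the projectors chosen at time t_k (ket / bra side). *)
Fixpoint kd_right_op {I : finType} (rho : Op C I) (E : nat -> Op C I -> Op C I)
    (R : nat -> Op C I) (k : nat) : Op C I :=
  match k with
  | 0 => opmul rho (R 0%N)
  | k'.+1 => opmul (E k' (kd_right_op rho E R k')) (R k'.+1)
  end.
Fixpoint kd_left_op {I : finType} (rho : Op C I) (E : nat -> Op C I -> Op C I)
    (L : nat -> Op C I) (k : nat) : Op C I :=
  match k with
  | 0 => opmul (L 0%N) rho
  | k'.+1 => opmul (L k'.+1) (E k' (kd_left_op rho E L k'))
  end.
Fixpoint kd_double_op {I : finType} (rho : Op C I) (E : nat -> Op C I -> Op C I)
    (L R : nat -> Op C I) (k : nat) : Op C I :=
  match k with
  | 0 => opmul (opmul (L 0%N) rho) (R 0%N)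
  | k'.+1 => opmul (opmul (L k'.+1) (E k' (kd_double_op rho E L R k'))) (R k'.+1)
  end.

Definition QKD_right {I : finType} (n : nat) rho E (R : nat -> Op C I) : C :=
  optr (kd_right_op rho E R n).
Definition QKD_left {I : finType} (n : nat) rho E (L : nat -> Op C I) : C :=
  optr (kd_left_op rho E L n).
Definition QKD_double {I : finType} (n : nat) rho E (L R : nat -> Op C I) : C :=
  optr (kd_double_op rho E L R n).
Definition QMH {I : finType} (n : nat) rho E (R : nat -> Op C I) : C :=
  'Re (QKD_right n rho E R).
Definition QMH_double {I : finType} (n : nat) rho E (L R : nat -> Op C I) : C :=
  'Re (QKD_double n rho E L R).
Definition QLvN {I : finType} (n : nat) rho E (L : nat -> Op C I) : C :=
  QKD_double n rho E L L.

Fixpoint compE {I : finType} (E : nat -> Op C I -> Op C I) (a m : nat) (X : Op C I)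
  : Op C I :=
  match m with
  | 0 => X
  | m'.+1 => E (a + m')%N (compE E a m' X)
  end.
Definition rho_at {I : finType} (E : nat -> Op C I -> Op C I) (rho : Op C I) (k : nat) :=
  compE E 0 k rho.
Definition subE {I : finType} (E : nat -> Op C I -> Op C I) (i : nat -> nat) :
  nat -> Op C I -> Op C I :=
  fun j => compE E (i j) (i j.+1 - i j).

(* ---------- multi-time Hilbert space H_{t_n} (x) ... (x) H_{t_0} ----------
   basis indexed by x : 'I_n.+1 -> 'I_d  (x k = basis index at time t_k) *)
Definition mT (d n : nat) := {ffun 'I_n.+1 -> 'I_d}.
Definition mIdx (d n : nat) := {ffun 'I_n.+1 -> 'I_(d ^ 2)}.

Definition tensT {d n : nat} (A : 'I_n.+1 -> Op C 'I_d) : Op C (mT d n) :=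
  fun x y => \prod_k A k (x k) (y k).
Definition pauliT {d n : nat} (sigma : 'I_(d ^ 2) -> Op C 'I_d) (mu : mIdx d n) :
  Op C (mT d n) := tensT (fun k => sigma (mu k)).

Section Temporal.
Variables (d : nat) (sigma : 'I_(d ^ 2) -> Op C 'I_d) (ev : 'I_(d ^ 2) -> 'I_d -> C)
          (P : 'I_(d ^ 2) -> 'I_d -> Op C 'I_d).
Variables (n : nat) (rho : Op C 'I_d) (E : nat -> Op C 'I_d -> Op C 'I_d).

Definition selP (mu : mIdx d n) (a : mT d n) : nat -> Op C 'I_d :=
  fun k => P (mu (inord k)) (a (inord k)).
Definition evprod (mu : mIdx d n) (a : mT d n) : C := \prod_k ev (mu k) (a k).

Definition corr_right (mu : mIdx d n) : C :=
  \sum_(a : mT d n) evprod mu a * QKD_right n rho E (selP mu a).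
Definition corr_left (mu : mIdx d n) : C :=
  \sum_(a : mT d n) evprod mu a * QKD_left n rho E (selP mu a).
Definition corr_double (mu nu : mIdx d n) : C :=
  \sum_(a : mT d n) \sum_(b : mT d n)
     evprod mu a * evprod nu b * QKD_double n rho E (selP mu a) (selP nu b).

Definition Ups_right : Op C (mT d n) :=
  fun x y => d%:R ^- n.+1 * \sum_(mu : mIdx d n) corr_right mu * pauliT sigma mu x y.
Definition Ups_left : Op C (mT d n) :=
  fun x y => d%:R ^- n.+1 * \sum_(mu : mIdx d n) corr_left mu * pauliT sigma mu x y.
Definition Ups_MH : Op C (mT d n) :=
  fun x y => d%:R ^- n.+1 * \sum_(mu : mIdx d n) 'Re (corr_right mu) * pauliT sigma mu x y.
(* doubled states on L (x) R, first component = L (ket side) *)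
Definition Ups_double : Op C (mT d n * mT d n)%type :=
  fun x y => d%:R ^- (2 * n.+1) * \sum_(mu : mIdx d n) \sum_(nu : mIdx d n)
     corr_double mu nu * pauliT sigma mu x.1 y.1 * pauliT sigma nu x.2 y.2.
Definition Ups_MH_double : Op C (mT d n * mT d n)%type :=
  fun x y => d%:R ^- (2 * n.+1) * \sum_(mu : mIdx d n) \sum_(nu : mIdx d n)
     'Re (corr_double mu nu) * pauliT sigma mu x.1 y.1 * pauliT sigma nu x.2 y.2.
End Temporal.

Definition ptrL {I : finType} (X : Op C (I * I)%type) : Op C I :=
  fun y y' => \sum_x X (x, y) (x, y').
Definition ptrR {I : finType} (X : Op C (I * I)%type) : Op C I :=
  fun x x' => \sum_y X (x, y) (x', y).

Definition marg1 {d n : nat} (k : 'I_n.+1) (X : Op C (mT d n)) : Op C 'I_d :=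
  fun i j => \sum_(x : mT d n | x k == i)
     \sum_(x' : mT d n | (x' k == j) && [forall l, (l != k) ==> (x' l == x l)])
        X x x'.

(* partial trace over all time steps not in the range of f : 'I_m.+1 -> 'I_n.+1;
   the kept factor at position j of the result is time step t_(f j). *)
Definition restr_eq {d n m : nat} (f : 'I_m.+1 -> 'I_n.+1) (x : mT d n) (y : mT d m) :=
  [forall j, x (f j) == y j].
Definition off_eq {d n m : nat} (f : 'I_m.+1 -> 'I_n.+1) (x x' : mT d n) :=
  [forall l, (l \notin codom f) ==> (x' l == x l)].
Definition marg {d n m : nat} (f : 'I_m.+1 -> 'I_n.+1) (X : Op C (mT d n)) :
    Op C (mT d m) :=
  fun y y' => \sum_(x : mT d n | restr_eq f x y)
     \sum_(x' : mT d n | restr_eq f x' y' && off_eq f x x') X x x'.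
Definition marg_double {d n m : nat} (f : 'I_m.+1 -> 'I_n.+1)
    (X : Op C (mT d n * mT d n)%type) : Op C (mT d m * mT d m)%type :=
  fun y y' =>
    \sum_(x : mT d n | restr_eq f x y.1)
    \sum_(x' : mT d n | restr_eq f x' y'.1 && off_eq f x x')
    \sum_(w : mT d n | restr_eq f w y.2)
    \sum_(w' : mT d n | restr_eq f w' y'.2 && off_eq f w w') X (x, w) (x', w').

End Ops.

(* Main.v *)
(* The generalized Paulis are d^2 orthogonal vectors in the space of operators,
   hence complete: |j><i| = d^-1 \sum_mu sigma_mu(i,j) sigma_mu.  The KD
   quasi-probability is linear in the projector chosen at each time, so the
   correlators are its values at the sigma's, and completeness collapses the
   Pauli expansion of the temporal state: its entry (x,y) is the KD form evaluated
   at the matrix units |y_k><x_k|.  Expanding arbitrary operators in matrix units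
   gives the Born rule, and partial traces are Born rules with identities inserted
   at the traced-out times: there a step of the process composes with the next one,
   or disappears by trace preservation after the last retained time.  The one-sided
   distributions are the doubled one with identities on the other side.  Conjugation
   swaps the two sides because positive maps preserve adjoints, by polarization of
   |v+cw><v+cw|; this gives the adjoint and Margenau-Hill identities. *)
Require Import Defs.
From HB Require Import structures.
From mathcomp Require Import all_boot all_order all_algebra.
From mathcomp Require Import ring zify.
From Stdlib Require Import FunctionalExtensionality.
Import Order.TTheory GRing.Theory Num.Theory.
Local Open Scope ring_scope.

(** * Operators and positive maps *)

Section OperatorAlgebra.
Context {C : numClosedFieldType}.

Lemma opP {I : finType} (X Y : Op C I) : (forall i j, X i j = Y i j) -> X = Y.
Proof.
move=> eqXY; apply: functional_extensionality => i.
exact: functional_extensionality.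
Qed.

(** Linearity is handled throughout as compatibility with these finite combinations, which merges
    additivity and homogeneity into one identity. *)
Definition opcomb {I A : finType} (c : A -> C) (B : A -> Op C I) : Op C I :=
  fun i j => \sum_a c a * B a i j.

Definition opunit {I : finType} (i j : I) : Op C I :=
  fun k l => ((k == i) && (l == j))%:R.

Lemma opmul1 {I : finType} (X : Op C I) : opmul X opone = X.
Proof.
apply: opP => i j; rewrite /opmul /opone (bigD1 j) //= eqxx mulr1 big1 ?addr0 //.
by move=> k /negbTE ->; rewrite mulr0.
Qed.

Lemma op1mul {I : finType} (X : Op C I) : opmul opone X = X.
Proof.
apply: opP => i j; rewrite /opmul /opone (bigD1 i) //= eqxx mul1r big1 ?addr0 //.
by move=> k; rewrite eq_sym => /negbTE ->; rewrite mul0r.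
Qed.

Lemma opmulA {I : finType} (X Y Z : Op C I) :
  opmul X (opmul Y Z) = opmul (opmul X Y) Z.
Proof.
apply: opP => i j; rewrite /opmul.
under eq_bigr do rewrite mulr_sumr.
rewrite exchange_big; apply: eq_bigr => k _; rewrite mulr_suml.
by apply: eq_bigr => l _; rewrite mulrA.
Qed.

Lemma optrC {I : finType} (X Y : Op C I) : optr (opmul X Y) = optr (opmul Y X).
Proof.
rewrite /optr /opmul exchange_big; apply: eq_bigr => i _.
by apply: eq_bigr => j _; rewrite mulrC.
Qed.

Lemma optr_unit {I : finType} (X : Op C I) (i j : I) :
  optr (opmul X (opunit j i)) = X i j.
Proof.
rewrite /optr /opmul (bigD1 i) //= (bigD1 j) //= /opunit !eqxx mulr1.
rewrite !big1 ?addr0 // => k /negbTE nk; last by rewrite nk mulr0.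
by rewrite big1 // => l _; rewrite nk andbF mulr0.
Qed.

Lemma opadjK {I : finType} (X : Op C I) : opadj (opadj X) = X.
Proof. by apply: opP => i j; rewrite /opadj conjCK. Qed.

Lemma opadj_mul {I : finType} (X Y : Op C I) :
  opadj (opmul X Y) = opmul (opadj Y) (opadj X).
Proof.
apply: opP => i j; rewrite /opadj /opmul rmorph_sum; apply: eq_bigr => k _.
by rewrite rmorphM mulrC.
Qed.

Lemma opadj1 {I : finType} : opadj (@opone C I) = opone.
Proof. by apply: opP => i j; rewrite /opadj /opone rmorph_nat eq_sym. Qed.

Lemma opadj_unit {I : finType} (i j : I) : opadj (opunit i j) = opunit j i.
Proof. by apply: opP => k l; rewrite /opadj /opunit rmorph_nat andbC. Qed.

Lemma optr_adj {I : finType} (X : Op C I) : optr (opadj X) = (optr X)^*.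
Proof. by rewrite /optr rmorph_sum. Qed.

Lemma opmul_combl {I A : finType} (c : A -> C) (B : A -> Op C I) (X : Op C I) :
  opmul (opcomb c B) X = opcomb c (fun a => opmul (B a) X).
Proof.
apply: opP => i j; rewrite /opmul /opcomb.
under eq_bigr do rewrite mulr_suml.
rewrite exchange_big; apply: eq_bigr => a _; rewrite mulr_sumr.
by apply: eq_bigr => k _; rewrite mulrA.
Qed.

Lemma opmul_combr {I A : finType} (c : A -> C) (B : A -> Op C I) (X : Op C I) :
  opmul X (opcomb c B) = opcomb c (fun a => opmul X (B a)).
Proof.
apply: opP => i j; rewrite /opmul /opcomb.
under eq_bigr do rewrite mulr_sumr.
rewrite exchange_big; apply: eq_bigr => a _; rewrite mulr_sumr.
by apply: eq_bigr => k _; rewrite mulrCA.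
Qed.

Lemma optr_comb {I A : finType} (c : A -> C) (B : A -> Op C I) :
  optr (opcomb c B) = \sum_a c a * optr (B a).
Proof.
rewrite /optr /opcomb exchange_big; apply: eq_bigr => a _.
by rewrite mulr_sumr.
Qed.

Lemma linmap_comb {I J A : finType} (E : Op C I -> Op C J) (c : A -> C)
    (B : A -> Op C I) :
  linmap E -> E (opcomb c B) = opcomb c (fun a => E (B a)).
Proof.
move=> linE.
(* [linmap] speaks only of a X + Y; taking a = -1 and X = Y = 0 gives E 0 = -E 0 + E 0 = 0. *)
have E0 : E opzero = opzero.
  have := linE (-1) opzero opzero.
  have -> : opadd (opscale (-1) opzero) opzero = opzero :> Op C I.
    by apply: opP => i j; rewrite /opadd /opscale /opzero mulr0 addr0.
  move=> E0; apply: opP => i j; rewrite E0 /opadd /opscale mulN1r.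
  exact: addNr.
(* Generalized to an arbitrary list of indices, so that induction applies. *)
suff EE r : E (fun i j => \sum_(a <- r) c a * B a i j) =
    fun i j => \sum_(a <- r) c a * E (B a) i j.
  exact: EE.
elim: r => [|a r IHr].
  transitivity (E opzero); first by congr E; apply: opP => i j; rewrite big_nil.
  by rewrite E0; apply: opP => i j; rewrite big_nil.
transitivity (E (opadd (opscale (c a) (B a))
                       (fun i j => \sum_(a <- r) c a * B a i j))).
  by congr E; apply: opP => i j; rewrite big_cons.
by rewrite linE IHr; apply: opP => i j; rewrite big_cons.
Qed.

(** Nested as rows, then columns, so that multilinear expansion can be applied once to each
    index. *)
Lemma op_comb_units {I : finType} (X : Op C I) :
  X = opcomb (fun=> 1) (fun i => opcomb (X i) (opunit i)).
Proof.
apply: opP => i j; rewrite /opcomb (bigD1 i) //= mul1r (bigD1 j) //= /opunit.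
rewrite !eqxx mulr1 !big1 ?addr0 // => k; rewrite eq_sym => /negbTE nk.
  by rewrite mul1r big1 // => l _; rewrite nk mulr0.
by rewrite nk andbF mulr0.
Qed.

(** The case c = 1 gives a + b and the case c = i gives a - b; adding them isolates a. *)
Lemma polarization (a b a' b' : C) :
  (forall c, c * a + c^* * b = (c * a' + c^* * b')^*) -> a = b'^*.
Proof.
move=> h; have := h 1; have := h 'i.
rewrite !rmorphD !rmorphM /= !conjCK conjC1 conjCi !mul1r => hi h1.
have {}hi : a - b = b'^* - a'^*.
  by apply: (mulfI (neq0Ci C)); rewrite mulrBr -mulNr hi; ring.
have n2 : 2%:R != 0 :> C by rewrite pnatr_eq0.
by apply: (mulfI n2); transitivity (a + b + (a - b)); [ring|rewrite h1 hi; ring].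
Qed.

(** [expands] records linearity in the first argument and conjugate-linearity in the second. By
    [diag] the terms at v and at w cancel, and [polarization] separates the two cross terms. *)
Lemma sesquilinear_conj {I : finType} (q q' : (I -> C) -> (I -> C) -> C) :
  let expands (s : (I -> C) -> (I -> C) -> C) := forall v w c,
    s (fun i => v i + c * w i) (fun i => v i + c * w i) =
      s v v + (c * s w v + c^* * s v w) + c * c^* * s w w in
  expands q -> expands q' -> (forall u, q u u = (q' u u)^*) ->
  forall v w, q v w = (q' w v)^*.
Proof.
move=> expands qD q'D diag v w.
apply: (polarization _ (q w v) (q' v w)) => c.
have := diag (fun i => w i + c * v i).
rewrite qD q'D !rmorphD !rmorphM /= !conjCK -!diag (mulrC c^* c).
by move/addIr/addrI.
Qed.

(** A nonnegative element of C is real, so the quadratic form of X is its own conjugate; polarizing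
    it and evaluating at basis vectors gives hermiticity. *)
Lemma psd_adj {I : finType} (X : Op C I) : psd X -> opadj X = X.
Proof.
move=> psdX.
pose q (v w : I -> C) := \sum_i \sum_j (w i)^* * X i j * v j.
have qD v w c : q (fun i => v i + c * w i) (fun i => v i + c * w i) =
     q v v + (c * q w v + c^* * q v w) + c * c^* * q w w.
  rewrite /q !mulr_sumr -!big_split; apply: eq_bigr => i _ /=.
  rewrite !mulr_sumr -!big_split; apply: eq_bigr => j _ /=.
  by rewrite rmorphD rmorphM /=; ring.
have qdelta i j : q (fun k => (k == j)%:R) (fun k => (k == i)%:R) = X i j.
  rewrite /q (bigD1 i) //= (bigD1 j) //= !eqxx conjC1 mul1r mulr1.
  rewrite !big1 ?addr0 // => k /negbTE nk; last by rewrite nk mulr0.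
  by rewrite big1 // => l _; rewrite nk conjC0 !mul0r.
apply: opP => i j; rewrite /opadj -!qdelta.
rewrite -(sesquilinear_conj q q) // => u.
by apply/esym/CrealP; rewrite ger0_real //; apply: psdX.
Qed.

(** The rank-one operator |v><w|. *)
Definition opdyad {I : finType} (v w : I -> C) : Op C I :=
  fun i j => v i * (w j)^*.

Lemma psd_dyad {I : finType} (v : I -> C) : psd (opdyad v v).
Proof.
move=> u; rewrite /opdyad.
have -> : \sum_i \sum_j (u i)^* * (v i * (v j)^*) * u j =
    (\sum_i (u i)^* * v i) * (\sum_i (u i)^* * v i)^*.
  rewrite rmorph_sum mulr_suml; apply: eq_bigr => i _.
  rewrite mulr_sumr; apply: eq_bigr => j _.
  by rewrite rmorphM /= conjCK; ring.
exact: mul_conjC_ge0.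
Qed.

Lemma opunit_dyad {I : finType} (i j : I) :
  opunit i j = opdyad (fun k => (k == i)%:R) (fun k => (k == j)%:R).
Proof.
by apply: opP => k l; rewrite /opunit /opdyad rmorph_nat -natrM mulnb.
Qed.

Lemma big_pair_ord1 {I : finType} (F : 'I_1 * I -> C) :
  \sum_p F p = \sum_i F (ord0, i).
Proof.
rewrite (eq_bigr (fun p => F (p.1, p.2))) => [|[]//].
by rewrite -(pair_bigA _ (fun a i => F (a, i))) big_ord1.
Qed.

(** Complete positivity with a one-dimensional ancilla. *)
Lemma cp_positive {I J : finType} (E : Op C I -> Op C J) (X : Op C I) :
  completely_positive E -> psd X -> psd (E X).
Proof.
move=> cpE psdX v.
have psdX1 : psd (fun p q : 'I_1 * I => X p.2 q.2).
  move=> u; rewrite big_pair_ord1; under eq_bigr do rewrite big_pair_ord1.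
  exact: (psdX (fun i => u (ord0, i))).
have := cpE 1%N _ psdX1 (fun p => v p.2).
by rewrite big_pair_ord1; under eq_bigr do rewrite big_pair_ord1.
Qed.

(** For v = w the image is positive, hence Hermitian. Both matrix entries are sesquilinear in (v,
    w), so polarization extends this to v different from w. *)
Lemma cp_dyad_adj {I J : finType} (E : Op C I -> Op C J) (v w : I -> C) :
  linmap E -> completely_positive E -> opadj (E (opdyad v w)) = E (opdyad w v).
Proof.
move=> linE cpE; apply: opP => k l; rewrite /opadj; apply/esym.
have ED v' w' c k' l' : E (opdyad (fun i => v' i + c * w' i)
      (fun i => v' i + c * w' i)) k' l' =
    E (opdyad v' v') k' l' + (c * E (opdyad w' v') k' l' +
    c^* * E (opdyad v' w') k' l') + c * c^* * E (opdyad w' w') k' l'.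
  have -> : opdyad (fun i => v' i + c * w' i) (fun i => v' i + c * w' i) =
    opadd (opscale c (opdyad w' v')) (opadd (opscale c^* (opdyad v' w'))
    (opadd (opscale (c * c^*) (opdyad w' w')) (opdyad v' v'))).
    by apply: opP => m m'; rewrite /opdyad /opadd /opscale rmorphD rmorphM /=; ring.
  by rewrite !linE /opadd /opscale; ring.
apply: (sesquilinear_conj (fun v w => E (opdyad v w) k l)
   (fun v w => E (opdyad v w) l k)) => [? ? ?|? ? ?|u]; [exact: ED..|].
rewrite -[in LHS](psd_adj (E (opdyad u u))) //.
exact/cp_positive/psd_dyad.
Qed.

Lemma linmap_units {I J : finType} (E : Op C I -> Op C J) (X : Op C I) k l :
  linmap E -> E X k l = \sum_i \sum_j X i j * E (opunit i j) k l.
Proof.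
move=> linE; rewrite {1}[X]op_comb_units linmap_comb // {1}/opcomb.
by apply: eq_bigr => i _; rewrite mul1r linmap_comb.
Qed.

(** Matrix units are dyads, and a linear map is determined by its values on them. *)
Lemma cp_adj {I J : finType} (E : Op C I -> Op C J) (X : Op C I) :
  linmap E -> completely_positive E -> E (opadj X) = opadj (E X).
Proof.
move=> linE cpE; apply: opP => k l.
rewrite [RHS]/opadj !(linmap_units E) // exchange_big rmorph_sum.
apply: eq_bigr => i _; rewrite rmorph_sum; apply: eq_bigr => j _ /=.
by rewrite rmorphM /= !opunit_dyad -(cp_dyad_adj E).
Qed.
End OperatorAlgebra.

(** * Multilinear forms and their representing operators *)

Section Multilinear.
Context {C : numClosedFieldType}.

(** The key type is general because the KD operators index times by [nat], while the forms below
    index them by ['I_n.+1]. *)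
Definition opset {K : eqType} {I : finType} (R : K -> Op C I) (k : K)
    (X : Op C I) : K -> Op C I :=
  fun l => if l == k then X else R l.

Definition multilinear {K : eqType} {I : finType} (F : (K -> Op C I) -> C) :=
  forall R k (A : finType) (c : A -> C) (B : A -> Op C I),
    F (opset R k (opcomb c B)) = \sum_a c a * F (opset R k (B a)).

Definition scons {T : Type} {n : nat} (x : T) (f : 'I_n -> T) : 'I_n.+1 -> T :=
  fun k => if unlift ord0 k is Some j then f j else x.

Lemma scons0 {T : Type} {n : nat} (x : T) (f : 'I_n -> T) :
  scons x f ord0 = x.
Proof. by rewrite /scons unlift_none. Qed.

Lemma sconsS {T : Type} {n : nat} (x : T) (f : 'I_n -> T) k :
  scons x f (lift ord0 k) = f k.
Proof. by rewrite /scons liftK. Qed.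

Lemma scons_eta {T : Type} {n : nat} (f : 'I_n.+1 -> T) :
  f = scons (f ord0) (fun k => f (lift ord0 k)).
Proof.
apply: functional_extensionality => k; rewrite /scons.
by case: unliftP => [j ->|->].
Qed.

(** [Y] is a placeholder: it presents the head as an updated slot, the shape in which [multilinear]
    applies. *)
Lemma scons_setl {I : finType} {n : nat} (Y X : Op C I) (R : 'I_n -> Op C I) :
  scons X R = opset (scons Y R) ord0 X.
Proof.
apply: functional_extensionality => k; rewrite /scons /opset.
by case: unliftP => [j ->|->].
Qed.

Lemma scons_setr {I : finType} {n : nat} (Y X : Op C I) (R : 'I_n -> Op C I) k :
  scons Y (opset R k X) = opset (scons Y R) (lift ord0 k) X.
Proof.
apply: functional_extensionality => l; rewrite /scons /opset.
case: unliftP => [j ->|->]; first by rewrite (inj_eq lift_inj).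
by rewrite (negbTE (neq_lift _ _)).
Qed.

Lemma big_ffun_scons {A : finType} {n : nat} (G : {ffun 'I_n.+1 -> A} -> C) :
  \sum_a G a = \sum_x \sum_(f : {ffun 'I_n -> A}) G [ffun k => scons x f k].
Proof.
rewrite pair_bigA.
rewrite (reindex (fun p : A * {ffun 'I_n -> A} => [ffun k => scons p.1 p.2 k])) //.
exists (fun a : {ffun 'I_n.+1 -> A} =>
  (a ord0, [ffun k : 'I_n => a (lift ord0 k)])) => [[x f] _|a _].
  rewrite ffunE scons0; congr pair; apply/ffunP => k.
  by rewrite !ffunE sconsS.
apply/ffunP => k; rewrite ffunE /=.
rewrite [in RHS](scons_eta a); congr (scons _ _ _).
by apply: functional_extensionality => l; rewrite ffunE.
Qed.

(** Induction on the number of slots: slot 0 is expanded by linearity, and the induction hypothesis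
    is applied to the form with slot 0 frozen. *)
Lemma multilinear_expand {I A : finType} (n : nat) (F : ('I_n -> Op C I) -> C)
    (c : 'I_n -> A -> C) (B : 'I_n -> A -> Op C I) :
  multilinear F ->
  F (fun k => opcomb (c k) (B k)) =
  \sum_(a : {ffun 'I_n -> A}) (\prod_k c k (a k)) * F (fun k => B k (a k)).
Proof.
elim: n F c B => [|n IHn] F c B linF.
  rewrite (big_pred1 (ffun0 (card_ord 0))).
    rewrite big_ord0 mul1r; congr F; apply: functional_extensionality.
    by case.
  by move=> a /=; apply/esym/eqP/ffunP; case.
rewrite big_ffun_scons [X in F X]scons_eta (scons_setl opzero) linF.
apply: eq_bigr => x _; rewrite -scons_setl.
rewrite (IHn (fun R => F (scons (B ord0 x) R))); last first.
  move=> R k A' c' B'; rewrite scons_setr linF.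
  by apply: eq_bigr => a' _; rewrite scons_setr.
rewrite mulr_sumr; apply: eq_bigr => f _.
rewrite big_ord_recl ffunE scons0 mulrA; congr (_ * _ * F _).
  by apply: eq_bigr => k _; rewrite ffunE sconsS.
rewrite [RHS]scons_eta ffunE scons0; congr scons.
by apply: functional_extensionality => k; rewrite ffunE sconsS.
Qed.

(** The indices are transposed so that pairing with a product operator by the trace returns the
    value of F there. *)
Definition state {d n : nat} (F : ('I_n.+1 -> Op C 'I_d) -> C) : Op C (mT d n) :=
  fun x y => F (fun k => opunit (y k) (x k)).

Lemma born_rule {d n : nat} (F : ('I_n.+1 -> Op C 'I_d) -> C)
    (R : 'I_n.+1 -> Op C 'I_d) :
  multilinear F -> F R = optr (opmul (tensT R) (state F)).
Proof.
move=> linF; rewrite {1}(_ : R = fun k => opcomb (fun=> 1)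
   (fun i => opcomb (R k i) (opunit i))); last first.
  by apply: functional_extensionality => k; apply: op_comb_units.
rewrite multilinear_expand //; apply: eq_bigr => x _.
by rewrite big1 // mul1r multilinear_expand.
Qed.

Lemma pauli_completeness {d : nat} (sigma : 'I_(d ^ 2) -> Op C 'I_d) (i j : 'I_d) :
  (0 < d)%N ->
  (forall mu nu, optr (opmul (sigma mu) (sigma nu)) = (d * (mu == nu))%:R) ->
  opunit j i = opcomb (fun mu => d%:R^-1 * sigma mu i j) sigma.
Proof.
move=> d_gt0 orth.
have dn0 : d%:R != 0 :> C by rewrite pnatr_eq0 -lt0n.
(* The rows of [M] are the vectorized sigma's and the columns of [N] their vectorized transposes
   over d, so the entries of M N are Tr(sigma_mu sigma_nu) / d. Both are square since [d ^ 2]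
   computes to [d * d]. *)
pose M : 'M[C]_(d * d) := \matrix_mu mxvec (\matrix_(k, l) sigma mu k l).
pose N : 'M[C]_(d * d) :=
  (\matrix_mu mxvec (\matrix_(k, l) (d%:R^-1 * sigma mu l k)))^T.
have MN : M *m N = 1%:M.
  apply/matrixP => mu nu; rewrite !mxE.
  rewrite (reindex _ (curry_mxvec_bij d d)) /=.
  transitivity (d%:R^-1 * optr (opmul (sigma mu) (sigma nu))).
    rewrite /optr /opmul pair_bigA mulr_sumr; apply: eq_bigr => -[k l] _ /=.
    by rewrite !mxE /= !mxvecE !mxE; ring.
  by rewrite orth natrM mulKf.
(* For square matrices a right inverse is a left inverse: this turns the
   orthogonality of the sigma's into their completeness. *)
have /matrixP NM := mulmx1C MN.
apply: opP => k l; have := NM (mxvec_index j i) (mxvec_index k l).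
rewrite !mxE (inj_eq (@cast_ord_inj _ _ _)) (inj_eq enum_rank_inj) xpair_eqE.
rewrite /opunit !(eq_sym _ j) !(eq_sym _ i) => <-; rewrite /opcomb.
by apply: eq_bigr => mu _; rewrite !mxE !mxvecE !mxE.
Qed.
End Multilinear.

(** * Pauli expansion and partial traces *)

Section States.
Context {C : numClosedFieldType}.

(** Read backwards, multilinearity turns the eigenvalue-weighted sum over outcomes into F at the
    sigma's. Completeness then sums over mu, each of the n+1 times using one factor 1/d. *)
Lemma pauli_expansion {d n : nat} (sigma : 'I_(d ^ 2) -> Op C 'I_d)
    (ev : 'I_(d ^ 2) -> 'I_d -> C) (P : 'I_(d ^ 2) -> 'I_d -> Op C 'I_d)
    (F : ('I_n.+1 -> Op C 'I_d) -> C) x y :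
  (0 < d)%N -> gen_pauli sigma ->
  (forall mu, spectral_decomp (sigma mu) (ev mu) (P mu)) -> multilinear F ->
  d%:R ^- n.+1 * (\sum_(mu : mIdx d n)
    (\sum_(a : mT d n) evprod d ev n mu a * F (fun k => P (mu k) (a k)))
      * pauliT sigma mu x y) = state F x y.
Proof.
move=> d_gt0 [_ _ _ orth] spec linF; rewrite /state.
rewrite (_ : (fun k => opunit _ _) = fun k =>
   opcomb (fun mu => d%:R^-1 * sigma mu (x k) (y k)) sigma); last first.
  by apply: functional_extensionality => k; apply: pauli_completeness.
rewrite multilinear_expand // mulr_sumr; apply: eq_bigr => mu _.
rewrite big_split /= prodr_const card_ord exprVn -!mulrA; congr (_ * _).
rewrite mulrC; congr (_ * _); rewrite /evprod.
rewrite -(multilinear_expand _ _ (fun k => ev (mu k)) (fun k => P (mu k))) //.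
congr F.
apply: functional_extensionality => k; apply: opP => i j.
by have [_ evE _] := spec (mu k); rewrite /opcomb evE.
Qed.

(** The product operator that extracts entry (y, y') of a partial trace: a matrix unit at each
    retained time and the identity at the traced-out ones. *)
Definition restrict {d n m : nat} (f : 'I_m.+1 -> 'I_n.+1) (y y' : mT d m) :
    'I_n.+1 -> Op C 'I_d :=
  fun l => if [pick j | f j == l] is Some j then opunit (y' j) (y j) else opone.

Lemma restrict_codom {d n m : nat} (f : 'I_m.+1 -> 'I_n.+1) (y y' : mT d m) j :
  injective f -> restrict f y y' (f j) = opunit (y' j) (y j).
Proof.
move=> injf; rewrite /restrict; case: pickP => [j' /eqP/injf ->//|/(_ j)].
by rewrite eqxx.
Qed.

Lemma restrict_off {d n m : nat} (f : 'I_m.+1 -> 'I_n.+1) (y y' : mT d m) l :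
  l \notin codom f -> restrict f y y' l = opone.
Proof.
by rewrite /restrict; case: pickP => // j /eqP <-; rewrite codom_f.
Qed.

Lemma prod_bool {I : finType} (b : I -> bool) :
  \prod_l ((b l)%:R : C) = [forall l, b l]%:R.
Proof.
case: (boolP [forall l, b l]) => [/forallP bT | /forallPn[l /negbTE bl]].
  by rewrite big1 // => l _; rewrite bT.
by rewrite (bigD1 l) //= bl mul0r.
Qed.

(** The right-hand side is the indicator of the summation range of [marg], so a partial trace
    becomes an ordinary trace against this product operator. *)
Lemma tensT_restrict {d n m : nat} (f : 'I_m.+1 -> 'I_n.+1) (y y' : mT d m)
    (x x' : mT d n) :
  injective f ->
  tensT (restrict f y y') x' x =
    [&& restr_eq f x y, restr_eq f x' y' & off_eq f x x']%:R.
Proof.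
move=> injf; rewrite /tensT.
pose b l := if [pick j | f j == l] is Some j then (x' l == y' j) && (x l == y j)
            else x' l == x l.
rewrite (eq_bigr (fun l => (b l)%:R)) => [|l _]; last first.
  by rewrite /restrict /b; case: pickP.
rewrite prod_bool; congr (nat_of_bool _)%:R.
have bf j : b (f j) = (x' (f j) == y' j) && (x (f j) == y j).
  rewrite /b; case: pickP => [j' /eqP/injf ->//|/(_ j)]; by rewrite eqxx.
have boff l : l \notin codom f -> b l = (x' l == x l).
  by rewrite /b; case: pickP => // j /eqP <-; rewrite codom_f.
apply/forallP/and3P => [bT|[/forallP xy /forallP xy' /forallP xx'] l].
  split; apply/forallP => j.
  - by have := bT (f j); rewrite bf => /andP[].
  - by have := bT (f j); rewrite bf => /andP[].
  - by apply/implyP => /boff <-.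
have [/codomP[j ->]|lf] := boolP (l \in codom f); first by rewrite bf xy xy'.
by rewrite boff //; apply: (implyP (xx' l)).
Qed.

Lemma marg_state {d n m : nat} (f : 'I_m.+1 -> 'I_n.+1)
    (F : ('I_n.+1 -> Op C 'I_d) -> C) y y' :
  injective f -> multilinear F -> marg f (state F) y y' = F (restrict f y y').
Proof.
move=> injf linF; rewrite (born_rule F) // /optr /opmul exchange_big /marg.
rewrite big_mkcond; apply: eq_bigr => x _.
case: ifP => [xy|nxy].
  rewrite big_mkcond; apply: eq_bigr => x' _; rewrite tensT_restrict // xy /=.
  by case: ifP; rewrite ?mul1r ?mul0r.
by rewrite big1 // => x' _; rewrite tensT_restrict // nxy mul0r.
Qed.

(** A marginal at one time is the partial trace along the constant embedding of a one-time index
    set. *)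
Lemma marg1E {d n : nat} (k : 'I_n.+1) (X : Op C (mT d n)) i j :
  marg1 k X i j = marg (fun _ : 'I_1 => k) X [ffun=> i] [ffun=> j].
Proof.
have restrE x u : restr_eq (fun _ : 'I_1 => k) x [ffun=> u] = (x k == u).
  by apply/forallP/idP => [/(_ ord0)|xk l]; rewrite ffunE.
have offE x x' : off_eq (fun _ : 'I_1 => k) x x' =
    [forall l, (l != k) ==> (x' l == x l)].
  apply: eq_forallb => l; congr (~~ _ ==> _).
  by apply/codomP/eqP => [[]//|->]; exists ord0.
apply: eq_big => [x|x _]; first by rewrite restrE.
by apply: eq_bigl => x'; rewrite restrE offE.
Qed.

Lemma restrict1 {d n : nat} (k : 'I_n.+1) (i j : 'I_d) :
  restrict (fun _ : 'I_1 => k) [ffun=> i] [ffun=> j] k = opunit j i.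
Proof.
rewrite /restrict; case: pickP => [l _|/(_ ord0)]; first by rewrite !ffunE.
by rewrite eqxx.
Qed.

Lemma tensT1 {d n : nat} :
  tensT (fun _ : 'I_n.+1 => opone) = opone :> Op C (mT d n).
Proof.
apply: opP => x y; rewrite /tensT /opone prod_bool; congr (nat_of_bool _)%:R.
apply/forallP/eqP => [xy|->//]; apply/ffunP => k; exact/eqP.
Qed.

End States.

(** * KD operators of a process: linearity, adjoints and composition of steps *)

Section Process.
Context {C : numClosedFieldType} {I : finType}.
Implicit Types (rho : Op C I) (E : nat -> Op C I -> Op C I) (L R : nat -> Op C I).

Lemma kd_rightE rho E R m :
  kd_right_op rho E R m = kd_double_op rho E (fun=> opone) R m.
Proof. by elim: m => [|m IHm] /=; rewrite ?IHm !op1mul. Qed.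

Lemma kd_leftE rho E L m :
  kd_left_op rho E L m = kd_double_op rho E L (fun=> opone) m.
Proof. by elim: m => [|m IHm] /=; rewrite ?IHm !opmul1. Qed.

(** Only times up to m are read, so values of the families beyond m may be arbitrary. *)
Lemma kd_double_ext rho E L L' R R' m :
  (forall l, (l <= m)%N -> L l = L' l) -> (forall l, (l <= m)%N -> R l = R' l) ->
  kd_double_op rho E L R m = kd_double_op rho E L' R' m.
Proof.
elim: m => [|m IHm] LL' RR' /=; first by rewrite LL' ?RR'.
by rewrite LL' ?RR' // IHm // => l lm; rewrite ?LL' ?RR' // leqW.
Qed.

(** At the last time the slot is an outer factor and the inner operator does not see it; at an
    earlier time the combination passes through the last map by linearity. *)
Lemma kd_double_combl {A : finType} rho E L R k (c : A -> C) B m :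
  (forall j, (j < m)%N -> linmap (E j)) -> (k <= m)%N ->
  kd_double_op rho E (opset L k (opcomb c B)) R m =
  opcomb c (fun a => kd_double_op rho E (opset L k (B a)) R m).
Proof.
have setE X : opset L k X k = X by rewrite /opset eqxx.
elim: m => [|m IHm] linE /=.
  rewrite leqn0 => /eqP k0; move: setE; rewrite k0 => setE.
  by rewrite setE !opmul_combl; congr opcomb;
    apply: functional_extensionality => a;
    rewrite setE.
rewrite leq_eqVlt => /orP[/eqP km|km].
  rewrite -km setE !opmul_combl; congr opcomb.
  apply: functional_extensionality => a.
  rewrite setE (kd_double_ext _ _ _ (opset L k (B a)) _ R) // => l lm.
  have /negbTE lk : l != k by rewrite neq_ltn km ltnS lm.
  by rewrite /opset lk.
rewrite IHm //; last by move=> j jm; apply/linE/leqW.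
rewrite (linmap_comb (E m) _ _ (linE m (ltnSn m)))
  opmul_combr opmul_combl; congr opcomb.
apply: functional_extensionality => a; congr (opmul (opmul _ _) _).
have /negbTE mk : m.+1 != k by rewrite neq_ltn km orbT.
by rewrite /opset mk.
Qed.

Lemma kd_double_combr {A : finType} rho E L R k (c : A -> C) B m :
  (forall j, (j < m)%N -> linmap (E j)) -> (k <= m)%N ->
  kd_double_op rho E L (opset R k (opcomb c B)) m =
  opcomb c (fun a => kd_double_op rho E L (opset R k (B a)) m).
Proof.
have setE X : opset R k X k = X by rewrite /opset eqxx.
elim: m => [|m IHm] linE /=.
  rewrite leqn0 => /eqP k0; move: setE; rewrite k0 => setE.
  by rewrite setE !opmul_combr; congr opcomb;
    apply: functional_extensionality => a;
    rewrite setE.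
rewrite leq_eqVlt => /orP[/eqP km|km].
  rewrite -km setE !opmul_combr; congr opcomb.
  apply: functional_extensionality => a.
  rewrite setE (kd_double_ext _ _ _ L _ (opset R k (B a))) // => l lm.
  have /negbTE lk : l != k by rewrite neq_ltn km ltnS lm.
  by rewrite /opset lk.
rewrite IHm //; last by move=> j jm; apply/linE/leqW.
rewrite (linmap_comb (E m) _ _ (linE m (ltnSn m)))
  opmul_combr opmul_combl; congr opcomb.
apply: functional_extensionality => a; congr (opmul _ _).
have /negbTE mk : m.+1 != k by rewrite neq_ltn km orbT.
by rewrite /opset mk.
Qed.

(** Adjunction reverses products, which exchanges the ket and bra sides, and it commutes with each
    map by [cp_adj]. *)
Lemma kd_double_adj rho E L R m :
  opadj rho = rho ->
  (forall j, (j < m)%N -> linmap (E j) /\ completely_positive (E j)) ->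
  opadj (kd_double_op rho E L R m) =
  kd_double_op rho E (fun k => opadj (R k)) (fun k => opadj (L k)) m.
Proof.
move=> rhoH; elim: m => [|m IHm] cpE /=; rewrite !opadj_mul opmulA ?rhoH //.
have [linE cE] := cpE m (ltnSn m).
by rewrite -cp_adj // IHm // => j jm; apply/cpE/leqW.
Qed.

Lemma linmap_compE E a m :
  (forall j, (j < m)%N -> linmap (E (a + j)%N)) -> linmap (compE E a m).
Proof.
elim: m => [|m IHm] linE c X Y //=.
rewrite IHm => [|j jm]; last exact/linE/leqW.
exact: linE.
Qed.

Lemma kd_double_gap rho E L R a m :
  (forall l, (a < l <= a + m)%N -> L l = opone /\ R l = opone) ->
  kd_double_op rho E L R (a + m) = compE E a m (kd_double_op rho E L R a).
Proof.
elim: m => [|m IHm] LR1; first by rewrite addn0.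
rewrite addnS /= IHm; last by move=> l lm; apply: LR1; lia.
by have [|-> ->] := LR1 (a + m).+1; [lia | rewrite op1mul opmul1].
Qed.

Lemma optr_kd_double_tail rho E L R k n :
  (k <= n)%N -> (forall j, (j < n)%N -> trace_preserving (E j)) ->
  (forall l, (k < l <= n)%N -> L l = opone /\ R l = opone) ->
  optr (kd_double_op rho E L R n) = optr (kd_double_op rho E L R k).
Proof.
move=> kn tpE LR1; rewrite -(subnKC kn) kd_double_gap ?subnKC //.
(* This bound is carried through the induction so that every map removed has index below n. *)
have : (k + (n - k) <= n)%N by rewrite subnKC.
elim: (n - k)%N => [//|m IHm] /= kmn; rewrite tpE ?IHm //; lia.
Qed.

Lemma kd_double_single rho E L R k :
  (forall l, (l < k)%N -> L l = opone /\ R l = opone) ->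
  kd_double_op rho E L R k = opmul (opmul (L k) (rho_at E rho k)) (R k).
Proof.
case: k => [//|k] LR1 /=; congr (opmul (opmul _ (E k _)) _).
rewrite -[k in LHS]add0n kd_double_gap => [|l lk]; last by apply: LR1; lia.
by have [//|/= -> ->] := LR1 0%N; rewrite op1mul opmul1.
Qed.

Lemma kd_double_subprocess rho E L R (i : nat -> nat) k :
  i 0%N = 0%N -> (forall j, (j < k)%N -> (i j < i j.+1)%N) ->
  (forall j l, (j < k)%N -> (i j < l < i j.+1)%N -> L l = opone /\ R l = opone) ->
  kd_double_op rho E L R (i k) =
  kd_double_op rho (subE E i) (fun j => L (i j)) (fun j => R (i j)) k.
Proof.
move=> i0; elim: k => [|k IHk] ilt LR1 /=; first by rewrite i0.
rewrite -IHk; first last.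
- by move=> j l jk; apply: LR1; apply: leqW.
- by move=> j jk; apply: ilt; apply: leqW.
have := ilt k (ltnSn k); rewrite /subE => ik.
(* Strict growth makes the gap nonempty: m steps have identities on both sides, and the last one
   ends at the retained time. *)
have [m im] : exists m, (i k.+1 - i k)%N = m.+1.
  by exists (i k.+1 - i k).-1; lia.
have im' : i k.+1 = (i k + m).+1 by lia.
rewrite im im' /= kd_double_gap // => l lm; apply: (LR1 k) => //; lia.
Qed.
End Process.

(** * Hermitian parts and the doubled Kirkwood-Dirac form *)

Section KDForm.
Context {C : numClosedFieldType}.

Definition herm_part {I : finType} (X : Op C I) : Op C I :=
  opscale (2%:R)^-1 (opadd X (opadj X)).

Lemma herm_part_adj {I : finType} (X : Op C I) :
  herm_part (opadj X) = herm_part X.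
Proof. by apply: opP => i j; rewrite /herm_part opadjK /opscale /opadd addrC. Qed.

(** Since c is real and each S mu is Hermitian, taking the adjoint conjugates only the coefficients
    T mu. *)
Lemma herm_part_sum {I M : finType} (c : C) (T : M -> C) (S : M -> Op C I) :
  c^* = c -> (forall mu, opadj (S mu) = S mu) ->
  (fun x y => c * \sum_mu 'Re (T mu) * S mu x y) =
  herm_part (fun x y => c * \sum_mu T mu * S mu x y).
Proof.
move=> cR SH; apply: opP => x y.
rewrite /herm_part /opscale /opadd /opadj rmorphM /= cR rmorph_sum -mulrDr.
rewrite -big_split mulrCA; congr (_ * _); rewrite mulr_sumr.
apply: eq_bigr => mu _ /=; rewrite rmorphM /= -[(S mu y x)^*]/(opadj (S mu) x y).
by rewrite SH ReE; ring.
Qed.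

(** For Hermitian A, cyclicity makes the trace of A against the adjoint of X the conjugate of Tr(A
    X). *)
Lemma optr_herm_part {I : finType} (A X : Op C I) :
  opadj A = A -> optr (opmul A (herm_part X)) = 'Re (optr (opmul A X)).
Proof.
move=> AH; rewrite ReE -optr_adj opadj_mul AH optrC -[in RHS]optrC.
rewrite /optr /opmul -big_split mulr_suml; apply: eq_bigr => i _ /=.
rewrite -big_split mulr_suml; apply: eq_bigr => j _ /=.
by rewrite /herm_part /opscale /opadd; ring.
Qed.

Lemma opadj_kron {I J : finType} (A : Op C I) (B : Op C J) :
  opadj (opkron A B) = opkron (opadj A) (opadj B).
Proof. by apply: opP => x y; rewrite /opadj /opkron rmorphM. Qed.

Lemma opadj_tensT {d n : nat} (A : 'I_n.+1 -> Op C 'I_d) :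
  opadj (tensT A) = tensT (fun k => opadj (A k)).
Proof. by apply: opP => x y; rewrite /opadj /tensT rmorph_prod. Qed.

Definition state2 {d n : nat}
    (F : ('I_n.+1 -> Op C 'I_d) -> ('I_n.+1 -> Op C 'I_d) -> C) :
    Op C (mT d n * mT d n)%type :=
  fun x y => F (fun k => opunit (y.1 k) (x.1 k)) (fun k => opunit (y.2 k) (x.2 k)).

(** The one-sided rule is applied in the ket slot with R fixed, then in the bra slot with matrix
    units on the ket side. *)
Lemma born_rule2 {d n : nat}
    (F : ('I_n.+1 -> Op C 'I_d) -> ('I_n.+1 -> Op C 'I_d) -> C) L R :
  (forall R, multilinear (F^~ R)) -> (forall L, multilinear (F L)) ->
  F L R = optr (opmul (opkron (tensT L) (tensT R)) (state2 F)).
Proof.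
move=> linL linR; rewrite (born_rule (F^~ R)) //.
transitivity (\sum_x \sum_u \sum_y \sum_v
    tensT L x y * tensT R u v * state2 F (y, v) (x, u)).
  apply: eq_bigr => x _; rewrite exchange_big; apply: eq_bigr => y _ /=.
  rewrite /state (born_rule (F _)) // mulr_sumr; apply: eq_bigr => u _.
  by rewrite mulr_sumr; apply: eq_bigr => v _; rewrite mulrA.
rewrite pair_bigA; apply: eq_bigr => -[x u] _.
by rewrite pair_bigA; apply: eq_bigr => -[y v] _.
Qed.

Lemma marg_double_state2 {d n m : nat} (f : 'I_m.+1 -> 'I_n.+1)
    (F : ('I_n.+1 -> Op C 'I_d) -> ('I_n.+1 -> Op C 'I_d) -> C) y y' :
  injective f -> (forall R, multilinear (F^~ R)) -> (forall L, multilinear (F L)) ->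
  marg_double f (state2 F) y y' = F (restrict f y.1 y'.1) (restrict f y.2 y'.2).
Proof.
move=> injf linL linR.
rewrite -(marg_state f (F^~ (restrict f y.2 y'.2))) //.
apply: eq_bigr => x _; apply: eq_bigr => x' _.
by rewrite /state -(marg_state f (F (fun k => opunit (x' k) (x k)))).
Qed.

(** Tracing out L is the Born rule with the identity at every ket time. *)
Lemma ptrL_state2 {d n : nat}
    (F : ('I_n.+1 -> Op C 'I_d) -> ('I_n.+1 -> Op C 'I_d) -> C) :
  (forall R, multilinear (F^~ R)) ->
  ptrL (state2 F) = state (F (fun=> opone)).
Proof.
move=> linL; apply: opP => y y'.
by rewrite /state (born_rule (F^~ (fun k => opunit (y' k) (y k)))) // tensT1 op1mul.
Qed.

Lemma ptrR_state2 {d n : nat}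
    (F : ('I_n.+1 -> Op C 'I_d) -> ('I_n.+1 -> Op C 'I_d) -> C) :
  (forall L, multilinear (F L)) ->
  ptrR (state2 F) = state (F^~ (fun=> opone)).
Proof.
move=> linR; apply: opP => x x'.
by rewrite /state (born_rule (F (fun k => opunit (x' k) (x k)))) // tensT1 op1mul.
Qed.

(** Families indexed by the n+1 times make this a form to which [multilinear] applies; [inord]
    converts times, and its default value is never read since only times up to n occur. *)
Definition kd_form {I : finType} (n : nat) (rho : Op C I) E
    (L R : 'I_n.+1 -> Op C I) : C :=
  QKD_double n rho E (fun k => L (inord k)) (fun k => R (inord k)).

Lemma kd_form_right {I : finType} n (rho : Op C I) E (R : 'I_n.+1 -> Op C I) :
  QKD_right n rho E (fun k => R (inord k)) = kd_form n rho E (fun=> opone) R.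
Proof. by rewrite /QKD_right kd_rightE. Qed.

Lemma kd_form_left {I : finType} n (rho : Op C I) E (L : 'I_n.+1 -> Op C I) :
  QKD_left n rho E (fun k => L (inord k)) = kd_form n rho E L (fun=> opone).
Proof. by rewrite /QKD_left kd_leftE. Qed.

(** The bound on l matters: beyond n, [inord] falls back to time 0. *)
Lemma opset_inord {I : finType} n (R : 'I_n.+1 -> Op C I) k X l :
  (l <= n)%N ->
  opset R k X (inord l) = opset (fun l => R (inord l)) (val k) X l.
Proof. by move=> ln; rewrite /opset -val_eqE /= inordK. Qed.

Lemma kd_form_linL {I : finType} n (rho : Op C I) E (R : 'I_n.+1 -> Op C I) :
  (forall j, (j < n)%N -> linmap (E j)) -> multilinear ((kd_form n rho E)^~ R).
Proof.
move=> linE L k A c B; rewrite /kd_form /QKD_double.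
have setE X : kd_double_op rho E (fun l => opset L k X (inord l))
    (fun l => R (inord l)) n = kd_double_op rho E
    (opset (fun l => L (inord l)) (val k) X) (fun l => R (inord l)) n.
  by apply: kd_double_ext => // l ln; apply: opset_inord.
have kn : (val k <= n)%N := leq_ord k.
rewrite setE (kd_double_combl _ _ _ _ _ _ _ _ linE kn) optr_comb.
by apply: eq_bigr => a _; rewrite setE.
Qed.

Lemma kd_form_linR {I : finType} n (rho : Op C I) E (L : 'I_n.+1 -> Op C I) :
  (forall j, (j < n)%N -> linmap (E j)) -> multilinear (kd_form n rho E L).
Proof.
move=> linE R k A c B; rewrite /kd_form /QKD_double.
have setE X : kd_double_op rho E (fun l => L (inord l))
    (fun l => opset R k X (inord l)) n = kd_double_op rho E
    (fun l => L (inord l)) (opset (fun l => R (inord l)) (val k) X) n.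
  by apply: kd_double_ext => // l ln; apply: opset_inord.
have kn : (val k <= n)%N := leq_ord k.
rewrite setE (kd_double_combr _ _ _ _ _ _ _ _ linE kn) optr_comb.
by apply: eq_bigr => a _; rewrite setE.
Qed.

Lemma kd_form_conj {I : finType} n (rho : Op C I) E (L R : 'I_n.+1 -> Op C I) :
  opadj rho = rho ->
  (forall j, (j < n)%N -> linmap (E j) /\ completely_positive (E j)) ->
  (kd_form n rho E L R)^* =
  kd_form n rho E (fun k => opadj (R k)) (fun k => opadj (L k)).
Proof.
by move=> rhoH cpE; rewrite /kd_form /QKD_double -optr_adj kd_double_adj.
Qed.

Lemma kd_form_single {I : finType} n (rho : Op C I) E (L R : 'I_n.+1 -> Op C I) k :
  (forall j, (j < n)%N -> trace_preserving (E j)) ->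
  (forall l, l != k -> L l = opone /\ R l = opone) ->
  kd_form n rho E L R = optr (opmul (opmul (L k) (rho_at E rho k)) (R k)).
Proof.
move=> tpE LR1; have kn := leq_ord k.
have off l : (l <= n)%N -> l != k -> inord l != k :> 'I_n.+1.
  by move=> ln; rewrite -val_eqE /= inordK.
rewrite /kd_form /QKD_double (optr_kd_double_tail _ _ _ _ k) //; last first.
  by move=> l /andP[kl ln]; apply/LR1/off; rewrite // neq_ltn kl orbT.
rewrite kd_double_single ?inord_val // => l lk.
by apply/LR1/off; rewrite ?neq_ltn ?lk // ltnW // (leq_trans lk).
Qed.

(** Trace preservation removes everything after the last retained time; between consecutive retained
    times the identities let the maps compose. *)
Lemma kd_form_subprocess {I : finType} n k (i : 'I_k.+1 -> 'I_n.+1) (rho : Op C I) E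
    (L R : 'I_n.+1 -> Op C I) :
  (forall j, (j < n)%N -> trace_preserving (E j)) ->
  val (i ord0) = 0%N -> (forall j j' : 'I_k.+1, (j < j')%N -> (i j < i j')%N) ->
  (forall l, l \notin codom i -> L l = opone /\ R l = opone) ->
  kd_form n rho E L R =
  kd_form k rho (subE E (fun j => val (i (inord j))))
    (fun j => L (i j)) (fun j => R (i j)).
Proof.
move=> tpE i0 imono LR1; set g := fun j : nat => val (i (inord j)).
have ile (j j' : 'I_k.+1) : (j <= j')%N -> (i j <= i j')%N.
  rewrite leq_eqVlt => /orP[/eqP/val_inj->//|/imono]; exact: ltnW.
have gn j : (g j <= n)%N := leq_ord _.
have g0 : g 0%N = 0%N.
  by rewrite /g -[RHS]i0; congr (val (i _)); apply/val_inj; rewrite /= inordK.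
have glt j : (j < k)%N -> (g j < g j.+1)%N.
  by move=> jk; apply: imono; rewrite !inordK // ltnS ltnW.
rewrite /kd_form /QKD_double (optr_kd_double_tail _ _ _ _ (g k)) //; last first.
  move=> l /andP[kl ln]; apply: LR1; apply/negP => /codomP[j lj].
  have : (i j <= g k)%N by apply: ile; rewrite inordK // leq_ord.
  by rewrite -lj inordK // leqNgt kl.
rewrite kd_double_subprocess //.
  by congr optr; apply: kd_double_ext => l lk; rewrite /g inord_val.
move=> j l jk /andP[jl lj]; have ln := leq_trans (ltnW lj) (gn _).
apply: LR1; apply/negP => /codomP[j' lj'].
have lE : l = i j' by rewrite -lj' inordK.
(* A retained time strictly between two consecutive ones would contradict monotonicity, on whichever
   side its index lies. *)
have [j'j|jj'] := leqP j' j.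
  have : (i j' <= g j)%N by apply: ile; rewrite inordK // ltnS ltnW.
  by rewrite -lE leqNgt jl.
have : (g j.+1 <= i j')%N by apply: ile; rewrite inordK.
by rewrite -lE leqNgt lj.
Qed.

(** Even when [inord] defaults, its image under i is a time at most n, so every map composed has
    index below n. *)
Lemma linmap_subE {I : finType} n k (i : 'I_k.+1 -> 'I_n.+1)
    (E : nat -> Op C I -> Op C I) :
  (forall j, (j < n)%N -> linmap (E j)) ->
  forall j, linmap (subE E (fun j => val (i (inord j))) j).
Proof.
move=> linE j; apply: linmap_compE => l lj; apply: linE.
have := leq_ord (i (inord j.+1)).
by move: lj => /=; lia.
Qed.

End KDForm.

(** * Temporal states *)

Section TemporalStates.
Context {C : numClosedFieldType}.
Context (d : nat) (hd : (0 < d)%N) (sigma : 'I_(d ^ 2) -> Op C 'I_d)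
  (ev : 'I_(d ^ 2) -> 'I_d -> C) (P : 'I_(d ^ 2) -> 'I_d -> Op C 'I_d).
Context (pauli : gen_pauli sigma)
  (spec : forall mu, spectral_decomp (sigma mu) (ev mu) (P mu)).

Lemma Ups_rightE n rho E :
  (forall j, (j < n)%N -> linmap (E j)) ->
  Ups_right d sigma ev P n rho E = state (kd_form n rho E (fun=> opone)).
Proof.
move=> linE; apply: opP => x y.
rewrite -(pauli_expansion sigma ev P) //; last exact: kd_form_linR.
congr (_ * _); apply: eq_bigr => mu _; congr (_ * _); apply: eq_bigr => a _.
by rewrite -kd_form_right.
Qed.

Lemma Ups_leftE n rho E :
  (forall j, (j < n)%N -> linmap (E j)) ->
  Ups_left d sigma ev P n rho E = state ((kd_form n rho E)^~ (fun=> opone)).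
Proof.
move=> linE; apply: opP => x y.
rewrite -(pauli_expansion sigma ev P) //; last exact: kd_form_linL.
congr (_ * _); apply: eq_bigr => mu _; congr (_ * _); apply: eq_bigr => a _.
by rewrite -kd_form_left.
Qed.

Lemma Ups_doubleE n rho E :
  (forall j, (j < n)%N -> linmap (E j)) ->
  Ups_double d sigma ev P n rho E = state2 (kd_form n rho E).
Proof.
move=> linE; apply: opP => x y.
rewrite /state2 -[RHS]/(state ((kd_form n rho E)^~ _) x.1 y.1).
rewrite -(pauli_expansion sigma ev P) //; last exact: kd_form_linL.
(* The normalization splits into one factor d^-(n+1) for each side. *)
rewrite /Ups_double mul2n -addnn -exprVn exprD !exprVn -mulrA; congr (_ * _).
rewrite mulr_sumr; apply: eq_bigr => mu _.
rewrite mulr_suml.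
(* The inner factor is the Pauli expansion of the bra side, which collapses for each fixed family of
   ket projectors. *)
transitivity (\sum_a evprod d ev n mu a * (d%:R ^- n.+1 * (\sum_(nu : mIdx d n)
    (\sum_b evprod d ev n nu b * kd_form n rho E (fun k => P (mu k) (a k))
      (fun k => P (nu k) (b k))) * pauliT sigma nu x.2 y.2)) *
      pauliT sigma mu x.1 y.1); last first.
  apply: eq_bigr => a _; rewrite (pauli_expansion sigma ev P) //.
  exact: kd_form_linR.
under [RHS]eq_bigr do rewrite !mulr_sumr mulr_suml.
rewrite exchange_big mulr_sumr; apply: eq_bigr => nu _.
rewrite /corr_double !mulr_suml !mulr_sumr; apply: eq_bigr => a _.
rewrite !mulr_suml !mulr_sumr mulr_suml; apply: eq_bigr => b _.
by rewrite /kd_form /selP; ring.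
Qed.

Lemma pauliT_adj n (mu : mIdx d n) : opadj (pauliT sigma mu) = pauliT sigma mu.
Proof.
have [_ sigmaH _ _] := pauli.
rewrite opadj_tensT; congr tensT; apply: functional_extensionality => k.
exact: sigmaH.
Qed.

Lemma Ups_MHE n rho E :
  Ups_MH d sigma ev P n rho E = herm_part (Ups_right d sigma ev P n rho E).
Proof.
apply: herm_part_sum => [|mu]; last exact: pauliT_adj.
by rewrite -exprVn rmorphXn /= fmorphV /= conjC_nat.
Qed.

Lemma Ups_MH_doubleE n rho E :
  Ups_MH_double d sigma ev P n rho E = herm_part (Ups_double d sigma ev P n rho E).
Proof.
pose S (p : mIdx d n * mIdx d n) := opkron (pauliT sigma p.1) (pauliT sigma p.2).
(* Pairs (mu, nu) become one index with Hermitian operator [S], the shape required by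
   [herm_part_sum]. *)
have sumE (T : mIdx d n -> mIdx d n -> C) :
    (fun x y => d%:R ^- (2 * n.+1) * \sum_mu \sum_nu
      T mu nu * pauliT sigma mu x.1 y.1 * pauliT sigma nu x.2 y.2) =
    (fun x y => d%:R ^- (2 * n.+1) * \sum_p T p.1 p.2 * S p x y).
  apply: opP => x y; congr (_ * _); rewrite pair_bigA; apply: eq_bigr => p _.
  by rewrite /S /opkron mulrA.
rewrite /Ups_MH_double /Ups_double.
rewrite sumE (sumE (corr_double d ev P n rho E)) -herm_part_sum // => [|p].
  by rewrite -exprVn rmorphXn /= fmorphV /= conjC_nat.
by rewrite opadj_kron !pauliT_adj.
Qed.

End TemporalStates.

Theorem theorem2 (C : numClosedFieldType) (d : nat) (hd : (0 < d)%N)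
  (sigma : 'I_(d ^ 2) -> Op C 'I_d) (ev : 'I_(d ^ 2) -> 'I_d -> C)
  (P : 'I_(d ^ 2) -> 'I_d -> Op C 'I_d)
  (n : nat) (rho : Op C 'I_d) (E : nat -> Op C 'I_d -> Op C 'I_d) :
  gen_pauli sigma ->
  (forall mu, spectral_decomp (sigma mu) (ev mu) (P mu)) ->
  density rho ->
  (forall j, (j < n)%N -> cptp (E j)) ->
  let Ur := Ups_right d sigma ev P n rho E in
  let Ul := Ups_left d sigma ev P n rho E in
  let U2 := Ups_double d sigma ev P n rho E in
  let UMH := Ups_MH d sigma ev P n rho E in
  let UMH2 := Ups_MH_double d sigma ev P n rho E in
  (* (1) *)
  [/\ Ur = ptrL U2, Ul = ptrR U2, Ur = opadj Ul,
      (forall k : 'I_n.+1, marg1 k Ur = rho_at E rho k /\ marg1 k Ul = rho_at E rho k)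
    & (forall (k : nat) (i : 'I_k.+1 -> 'I_n.+1),
         val (i ord0) = 0%N ->
         (forall j j' : 'I_k.+1, (j < j')%N -> (i j < i j')%N) ->
         let E' := subE E (fun j => val (i (inord j))) in
         [/\ marg i Ur = Ups_right d sigma ev P k rho E',
             marg i Ul = Ups_left d sigma ev P k rho E'
           & marg_double i U2 = Ups_double d sigma ev P k rho E'])] /\
  (* (2) *)
  [/\ UMH = opscale (2%:R)^-1 (opadd Ul (opadj Ul)),
      UMH = opscale (2%:R)^-1 (opadd Ur (opadj Ur)),
      UMH2 = opscale (2%:R)^-1 (opadd U2 (opadj U2))
    & forall k : 'I_n.+1, marg1 k UMH = rho_at E rho k] /\
  (* (3) temporal Born rule *)
  (forall (A B : 'I_n.+1 -> finType)
          (Pa : forall k, A k -> Op C 'I_d) (Pb : forall k, B k -> Op C 'I_d),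
     (forall k, proj_family (Pa k)) -> (forall k, proj_family (Pb k)) ->
     forall (a : forall k, A k) (b : forall k, B k),
     let PA := fun k : 'I_n.+1 => Pa k (a k) in
     let PB := fun k : 'I_n.+1 => Pb k (b k) in
     let PAn := fun k : nat => PA (inord k) in
     let PBn := fun k : nat => PB (inord k) in
     [/\ QKD_right n rho E PBn = optr (opmul (tensT PB) Ur),
         QKD_left n rho E PBn = optr (opmul (tensT PB) Ul)
       & QKD_double n rho E PAn PBn = optr (opmul (opkron (tensT PA) (tensT PB)) U2)] /\
     [/\ QMH n rho E PBn = optr (opmul (tensT PB) UMH),
         QMH_double n rho E PAn PBn = optr (opmul (opkron (tensT PA) (tensT PB)) UMH2),
         QLvN n rho E PAn = optr (opmul (opkron (tensT PA) (tensT PA)) U2)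
       & QLvN n rho E PAn = optr (opmul (opkron (tensT PA) (tensT PA)) UMH2)]).
Proof.
move=> pauli spec [rho_psd _] cptpE.
have linE j : (j < n)%N -> linmap (E j) by move=> /cptpE[].
have cpE j : (j < n)%N -> linmap (E j) /\ completely_positive (E j).
  by move=> /cptpE[].
have tpE j : (j < n)%N -> trace_preserving (E j) by move=> /cptpE[].
have rhoH := psd_adj rho rho_psd.
move=> Ur Ul U2 UMH UMH2.
have linL R := kd_form_linL n rho E R linE.
have linR L := kd_form_linR n rho E L linE.
have UrE : Ur = state (kd_form n rho E (fun=> opone)) by apply: Ups_rightE.
have UlE : Ul = state ((kd_form n rho E)^~ (fun=> opone)) by apply: Ups_leftE.
have U2E : U2 = state2 (kd_form n rho E) by apply: Ups_doubleE.
(* Conjugating the form swaps its sides; identities are self-adjoint, and adjoints of matrix units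
   exchange x and y as the adjoint state requires. *)
have UrUl : Ur = opadj Ul.
  rewrite UrE UlE; apply: opP => x y; rewrite /opadj /state kd_form_conj //.
  rewrite opadj1; congr kd_form; apply: functional_extensionality => k.
  by rewrite opadj_unit.
have UMHE : UMH = herm_part Ur by apply: Ups_MHE.
have UMH2E : UMH2 = herm_part U2 by apply: Ups_MH_doubleE.
have injk (k : 'I_n.+1) : injective (fun _ : 'I_1 => k).
  by move=> j j' _; rewrite !ord1.
have offk (k l : 'I_n.+1) : l != k -> l \notin codom (fun _ : 'I_1 => k).
  by move=> lk; apply/negP => /codomP[_ lk']; rewrite lk' eqxx in lk.
have margr k : marg1 k Ur = rho_at E rho k.
  apply: opP => i j.
  rewrite marg1E UrE marg_state // (kd_form_single _ _ _ _ _ k) //.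
    by rewrite restrict1 op1mul optr_unit.
  by move=> l lk; rewrite restrict_off // offk.
have margl k : marg1 k Ul = rho_at E rho k.
  apply: opP => i j.
  rewrite marg1E UlE marg_state // (kd_form_single _ _ _ _ _ k) //.
    by rewrite restrict1 opmul1 optrC optr_unit.
  by move=> l lk; rewrite restrict_off // offk.
split; [split=> // | split; [split=> // | ]].
- by rewrite U2E ptrL_state2.
- by rewrite U2E ptrR_state2.
- move=> k i i0 imono E'.
  have linE' j : (j < k)%N -> linmap (E' j) by move=> _; apply: linmap_subE.
  have injI : injective i.
    move=> j j' ij; apply/val_inj; case: (ltngtP j j') => // /imono;
      by rewrite ij ltnn.
  have subP L R : (forall l, l \notin codom i -> L l = opone /\ R l = opone) ->
      kd_form n rho E L R = kd_form k rho E' (fun j => L (i j)) (fun j => R (i j)).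
    exact: kd_form_subprocess.
  have restrI (y y' : mT d k) :
      (fun j => restrict i y y' (i j)) = fun j => @opunit C _ (y' j) (y j).
    by apply: functional_extensionality => j; apply: restrict_codom.
  split.
  + rewrite Ups_rightE // UrE; apply: opP => y y'.
    rewrite marg_state // subP => [|l li]; first by rewrite restrI.
    by rewrite restrict_off.
  + rewrite Ups_leftE // UlE; apply: opP => y y'.
    rewrite marg_state // subP => [|l li]; first by rewrite restrI.
    by rewrite restrict_off.
  + rewrite Ups_doubleE // U2E; apply: opP => y y'.
    rewrite marg_double_state2 // subP => [|l li]; first by rewrite !restrI.
    by rewrite !restrict_off.
- by rewrite UMHE UrUl herm_part_adj.
- move=> k; apply: opP => i j.
  (* The adjoint of Ur is Ul, so the MH state averages two states with the same marginal, and
     [marg1] is linear. *)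
  have -> : UMH = opscale 2%:R^-1 (opadd Ur Ul).
    by rewrite UMHE /herm_part {2}UrUl opadjK.
  transitivity (2%:R^-1 * (marg1 k Ur i j + marg1 k Ul i j)).
    rewrite /marg1 -big_split mulr_sumr; apply: eq_bigr => x _ /=.
    by rewrite -big_split mulr_sumr.
  by rewrite margr margl -mulr2n -[X in _ * X]mulr_natl mulKf // pnatr_eq0.
- move=> A B Pa Pb projA projB a b PA PB PAn PBn.
  have tensH (I' : 'I_n.+1 -> finType) (Q : forall k, I' k -> Op C 'I_d)
      (c : forall k, I' k) : (forall k, proj_family (Q k)) ->
      opadj (tensT (fun k => Q k (c k))) = tensT (fun k => Q k (c k)).
    move=> projQ; rewrite opadj_tensT; congr tensT.
    by apply: functional_extensionality => k; have [/(_ (c k))[]] := projQ k.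
  have tAH := tensH A Pa a projA; have tBH := tensH B Pb b projB.
  have bornr : QKD_right n rho E PBn = optr (opmul (tensT PB) Ur).
    by rewrite UrE kd_form_right (born_rule (kd_form _ _ _ _)).
  have bornl : QKD_left n rho E PBn = optr (opmul (tensT PB) Ul).
    by rewrite UlE kd_form_left (born_rule ((kd_form _ _ _)^~ _)).
  have born2 L R :
      kd_form n rho E L R = optr (opmul (opkron (tensT L) (tensT R)) U2).
    by rewrite U2E born_rule2.
  split; split=> //.
  + exact: born2.
  + by rewrite UMHE optr_herm_part // /QMH bornr.
  + by rewrite UMH2E optr_herm_part -?born2 // opadj_kron tAH tBH.
  + exact: born2.
  (* With the same projectors on both sides, conjugation fixes the form: the LvN value is real and
     equals its real part. *)
  + rewrite UMH2E optr_herm_part -?born2 ?opadj_kron ?tAH //.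
    apply/esym/Creal_ReP/CrealP; rewrite kd_form_conj //.
    have PAH : (fun k => opadj (PA k)) = PA.
      by apply: functional_extensionality => k; have [/(_ (a k))[]] := projA k.
    by rewrite PAH.
Qed.
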